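(* Let $(A,\Phi)$ be a dual $\ell$CEDS. The permutative products in $\mathbf{Perm}_\Phi$ are of one of the following forms: - $\diamond_a$, where $a\in A$ is a special vector of $(A,\Phi)$ of eigenvalue $1$; - $\diamond_a+\diamond_a^{op}$, where $a\in A$ is a weak special vector of $(A,\Phi)$. The $0$-permutative products in $\mathbf{Perm}_\Phi$ are the products $\diamond_a$, where $a\in A$ is a special vector of $(A,\Phi)$ of eigenvalue $0$.
   Context: $\mathbb{K}$ is a field of characteristic zero and all vector spaces are over $\mathbb{K}$; $\tau$ is the flip of $A\otimes A$. A dual $\ell$CEDS is a pair $(A,\Phi)$ with $A$ a vector space and $\Phi:A\otimes A\to A\otimes A$ linear such that $(\mathrm{Id}\otimes\Phi)\circ(\Phi\otimes\mathrm{Id})\circ(\mathrm{Id}\otimes\Phi)=(\Phi\otimes\mathrm{Id})\circ(\mathrm{Id}\otimes\tau)\circ(\Phi\otimes\mathrm{Id})$ and $(\Phi\otimes\mathrm{Id})\circ(\tau\otimes\mathrm{Id})\circ(\mathrm{Id}\otimes\tau)\circ(\mathrm{Id}\otimes\Phi)=(\mathrm{Id}\otimes\tau)\circ(\mathrm{Id}\otimes\Phi)\circ(\Phi\otimes\mathrm{Id})\circ(\tau\otimes\mathrm{Id})$. With formal Sweedler notation $\Phi(a\otimes b)=\sum a'\curvearrowright b'\otimes a''\blacktriangleright b''$, an $(A,\Phi)$-permutative algebra is a vector space $V$ with products $\diamond_a:V\otimes V\to V$, depending linearly on $a\in A$, such that for all $x,y,z\in V$, $a,b\in A$: $$(x\diamond_b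 y)\diamond_a z=\sum x\diamond_{a'\curvearrowright b'}(y\diamond_{a''\blacktriangleright b''}z),\qquad x\diamond_a(y\diamond_b z)=y\diamond_b(x\diamond_a z).$$ $\mathbf{Perm}_\Phi$ is the operad of these algebras, generated by the elements $\diamond_a\in\mathbf{Perm}_\Phi(2)$; $x\diamond_a^{op}y=y\diamond_a x$. A permutative product in $\mathbf{Perm}_\Phi$ is an element $\diamond\in\mathbf{Perm}_\Phi(2)$ satisfying in the operad the identities $(x\diamond y)\diamond z=x\diamond(y\diamond z)$ and $x\diamond(y\diamond z)=y\diamond(x\diamond z)$. A $0$-permutative product is an element $\diamond\in\mathbf{Perm}_\Phi(2)$ satisfying $(x\diamond y)\diamond z=0$ and $x\diamond(y\diamond z)=y\diamond(x\diamond z)$. A vector $a\in A$ is a special vector of eigenvalue $\lambda\in\mathbb{K}$ if $\Phi(a\otimes a)=\lambda\,a\otimes a$, and a weak special vector if $\Phi(a\otimes a)+\tau\circ\Phi(a\otimes a)=a\otimes a$. *)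

(* Defs.v *)
From HB Require Import structures.
From mathcomp Require Import all_boot all_order all_algebra perm zify.
From mathcomp Require Import finmap monalg.
From mathcomp.classical Require Import boolp.

Set Implicit Arguments.
Unset Strict Implicit.
Unset Printing Implicit Defensive.

Import GRing.Theory.
Local Open Scope ring_scope.
Local Open Scope quotient_scope.

Lemma linear_subr (K : fieldType) (U W : lmodType K) (f : U -> W) :
  linear f -> forall x y, f x - f y = f (x - y).
Proof. by move=> fl x y; rewrite addrC -scaleN1r -fl scaleN1r addrC. Qed.

Section Span.
Variables (K : fieldType) (V : lmodType K).

Inductive span (R : V -> Prop) : V -> Prop :=
| span0 : span R 0
| span_cons k x y : R x -> span R y -> span R (k *: x + y).

Variable R : V -> Prop.

Lemma spanZ k x : span R x -> span R (k *: x).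
Proof.
elim=> [|c y z Ry _ IH]; first by rewrite scaler0; exact: span0.
by rewrite scalerDr scalerA; exact: span_cons.
Qed.

Lemma spanD x y : span R x -> span R y -> span R (x + y).
Proof.
move=> + Sy; elim=> [|c u z Ru _ IH]; first by rewrite add0r.
by rewrite -addrA; exact: span_cons.
Qed.

Lemma span_gen x : R x -> span R x.
Proof.
move=> Rx; rewrite -[x]addr0 -[x in x + 0]scale1r.
by apply: span_cons => //; exact: span0.
Qed.

Definition span_pred : {pred V} := fun x => `[< span R x >].

Lemma span_predP x : reflect (span R x) (x \in span_pred).
Proof. exact: asboolP. Qed.

Lemma span_zmod_closed : zmod_closed span_pred.
Proof.
split; first by apply/span_predP; exact: span0.
move=> x y /span_predP Sx /span_predP Sy; apply/span_predP.
by rewrite -scaleN1r; apply: spanD => //; exact: spanZ.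
Qed.

HB.instance Definition _ := GRing.isZmodClosed.Build V span_pred span_zmod_closed.

(* The quotient vector space V / span R. *)
Definition lquot : Type := Quotient.quot (GRing.ZmodClosed.clone V span_pred _).
HB.instance Definition _ := GRing.Zmodule.on lquot.

Definition qpi (x : V) : lquot := \pi_(Quotient.quot _) x.
Definition qrepr (x : lquot) : V := repr x.

Lemma qreprK : cancel qrepr qpi.
Proof. exact: reprK. Qed.

Lemma qpi_eq x y : qpi x = qpi y <-> span R (x - y).
Proof.
split=> [/eqP|/span_predP Sxy].
  by rewrite -Quotient.idealrBE => /span_predP.
by apply/eqP; rewrite -Quotient.idealrBE.
Qed.

Lemma qpi_zmod : zmod_morphism qpi.
Proof. by move=> x y; rewrite /qpi raddfB. Qed.
HB.instance Definition _ := GRing.isZmodMorphism.Build V lquot qpi qpi_zmod.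

Definition qscale (k : K) (x : lquot) : lquot := qpi (k *: qrepr x).

Lemma qpiZ k x : qscale k (qpi x) = qpi (k *: x).
Proof.
apply/qpi_eq; rewrite -scalerBr; apply: spanZ.
by apply/qpi_eq; rewrite qreprK.
Qed.

Lemma qscaleA a b v : qscale a (qscale b v) = qscale (a * b) v.
Proof. by rewrite -[v]qreprK !qpiZ scalerA. Qed.
Lemma qscale1 : left_id 1 qscale.
Proof. by move=> v; rewrite -[v]qreprK !qpiZ scale1r. Qed.
Lemma qscaleDr : right_distributive qscale +%R.
Proof.
move=> a u v; rewrite -[u]qreprK -[v]qreprK.
by rewrite -raddfD !qpiZ scalerDr raddfD.
Qed.
Lemma qscaleDl v : {morph qscale^~ v : a b / a + b}.
Proof. by move=> a b; rewrite -[v]qreprK !qpiZ scalerDl raddfD. Qed.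

HB.instance Definition _ :=
  GRing.Zmodule_isLmodule.Build K lquot qscaleA qscale1 qscaleDr qscaleDl.

Lemma qpi_scalable : scalable qpi.
Proof. by move=> k x; rewrite -qpiZ. Qed.
HB.instance Definition _ := GRing.isScalable.Build K V lquot _ qpi qpi_scalable.

Lemma qpi_rel k x y z : R (x - (k *: y + z)) -> qpi x = k *: qpi y + qpi z.
Proof. by move=> Rxyz; rewrite -linearP; apply/qpi_eq; exact: span_gen. Qed.

End Span.

Section FreeModule.
Variables (K : fieldType) (X : choiceType) (W : lmodType K).

(* The linear extension to the free module {malg K[X]} of a map on its basis. *)
Definition mlin (f : X -> W) (g : {malg K[X]}) : W :=
  \sum_(x <- msupp g) g@_x *: f x.

Variable f : X -> W.

Lemma mlinEw (D : {fset X}) g : (msupp g `<=` D)%fset ->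
  mlin f g = \sum_(x <- D) g@_x *: f x.
Proof.
move=> sgD; apply: big_fset_incl => // x _ xg.
by rewrite mcoeff_outdom ?scale0r.
Qed.

Lemma mlin_linear : linear (mlin f).
Proof.
move=> k g h; pose D := (msupp g `|` msupp h `|` msupp (k *: g + h)%R)%fset.
rewrite !(@mlinEw D); first last.
- by apply/fsubsetP => x xg; rewrite !in_fsetU xg !orbT.
- by apply/fsubsetP => x xg; rewrite !in_fsetU xg.
- by apply/fsubsetP => x xg; rewrite !in_fsetU xg !orbT.
rewrite scaler_sumr -big_split; apply: eq_bigr => x _ /=.
by rewrite mcoeffD mcoeffZ scalerDl scalerA.
Qed.
HB.instance Definition _ :=
  GRing.isLinear.Build K {malg K[X]} W _ (mlin f) mlin_linear.

Lemma mlinU x : mlin f << x >> = f x.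
Proof.
rewrite (@mlinEw [fset x]%fset) ?msuppU_le //.
by rewrite big_seq_fset1 mcoeffUU scale1r.
Qed.

Lemma mlin_rel k x y z :
  mlin f (<< x >> - (k *: << y >> + << z >>)) = f x - (k *: f y + f z).
Proof. by rewrite raddfB /= mlin_linear !mlinU. Qed.

(* The map induced by f on the vector space presented by the generators X and
   the relations R; it is meaningful when mlin f vanishes on R. *)
Definition plift (R : {malg K[X]} -> Prop) (x : lquot R) : W :=
  mlin f (qrepr x).

Variables (R : {malg K[X]} -> Prop) (fR : forall r, R r -> mlin f r = 0).

Lemma mlin_span r : span R r -> mlin f r = 0.
Proof.
elim=> [|k x y Rx _ IH]; first exact: linear0.
by rewrite linearP /= IH fR // scaler0 addr0.
Qed.

Lemma plift_pi g : plift (qpi R g) = mlin f g.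
Proof.
apply/eqP; rewrite /plift -subr_eq0 -linearB; apply/eqP/mlin_span.
by apply/qpi_eq; rewrite qreprK.
Qed.

Lemma plift_linear : linear (@plift R).
Proof.
move=> k x y; rewrite -[x]qreprK -[y]qreprK -linearP !plift_pi.
exact: linearP.
Qed.

End FreeModule.

Arguments plift {K X W} f {R} x.

Section Tensor.
Variables (K : fieldType).
Implicit Types U V W : lmodType K.

Definition bilinear U V W (h : U -> V -> W) : Prop :=
  (forall v, linear (h^~ v)) /\ (forall u, linear (h u)).

Inductive tens_rel U V : {malg K[(U * V)%type]} -> Prop :=
| tens_rel_l k u u' v :
    tens_rel (<< (k *: u + u', v) >> - (k *: << (u, v) >> + << (u', v) >>))
| tens_rel_r k u v v' :
    tens_rel (<< (u, k *: v + v') >> - (k *: << (u, v) >> + << (u, v') >>)).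

Definition tens U V : Type := lquot (@tens_rel U V).
HB.instance Definition _ U V := GRing.Lmodule.on (tens U V).

Definition tpure U V (u : U) (v : V) : tens U V :=
  qpi (@tens_rel U V) << (u, v) >>.

Definition tlift U V W (h : U -> V -> W) : tens U V -> W :=
  plift (fun p : U * V => h p.1 p.2).

Lemma tpure_bilinear U V : bilinear (@tpure U V).
Proof.
split=> [v k u u'|u k v v'].
  exact: (@qpi_rel K _ (@tens_rel U V) k _ _ _ (tens_rel_l k u u' v)).
exact: (@qpi_rel K _ (@tens_rel U V) k _ _ _ (tens_rel_r k u v v')).
Qed.

Lemma tlift_rel U V W (h : U -> V -> W) : bilinear h ->
  forall r, tens_rel r -> mlin (fun p => h p.1 p.2) r = 0.
Proof.
by case=> hl hr _ [] *; rewrite mlin_rel /= ?hl ?hr subrr.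
Qed.

Lemma tliftE U V W (h : U -> V -> W) : bilinear h ->
  forall u v, tlift h (tpure u v) = h u v.
Proof. by move=> /tlift_rel hh u v; rewrite /tlift plift_pi // mlinU. Qed.

Lemma tlift_linear U V W (h : U -> V -> W) : bilinear h -> linear (tlift h).
Proof. by move=> /tlift_rel hh; exact: plift_linear. Qed.

Definition tmap U V U' V' (f : U -> U') (g : V -> V') : tens U V -> tens U' V' :=
  tlift (fun u v => tpure (f u) (g v)).

Definition tflip U V : tens U V -> tens V U := tlift (fun u v => tpure v u).

Definition tassoc U V W : tens (tens U V) W -> tens U (tens V W) :=
  tlift (fun x w => tlift (fun u v => tpure u (tpure v w)) x).

Definition tassocV U V W : tens U (tens V W) -> tens (tens U V) W :=
  tlift (fun u y => tlift (fun v w => tpure (tpure u v) w) y).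

Lemma tmapE U V U' V' (f : U -> U') (g : V -> V') : linear f -> linear g ->
  forall u v, tmap f g (tpure u v) = tpure (f u) (g v).
Proof.
move=> fL gL; apply: tliftE; have [tl tr] := tpure_bilinear U' V'.
by split=> [v k u u'|u k v v']; rewrite ?fL ?gL ?tl ?tr.
Qed.

Lemma tflipE U V (u : U) (v : V) : tflip (tpure u v) = tpure v u.
Proof.
by apply: tliftE; have [tl tr] := tpure_bilinear V U; split=> *; rewrite ?tl ?tr.
Qed.

Lemma tassocE U V W (u : U) (v : V) (w : W) :
  tassoc (tpure (tpure u v) w) = tpure u (tpure v w).
Proof.
have [tl tr] := tpure_bilinear U (tens V W).
have [sl sr] := tpure_bilinear V W.
have bil (w' : W) : bilinear (fun (u' : U) (v' : V) => tpure u' (tpure v' w')).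
  by split=> [v' k x y|u' k x y]; [exact: tl | rewrite /= (sl w') tr].
rewrite /tassoc tliftE ?tliftE //; split=> [w'|x]; first exact: tlift_linear.
move=> k w1 w2; rewrite /tlift /plift /mlin scaler_sumr -big_split.
by apply: eq_bigr => p _ /=; rewrite sr tr scalerDr !scalerA mulrC.
Qed.

Lemma tassocVE U V W (u : U) (v : V) (w : W) :
  tassocV (tpure u (tpure v w)) = tpure (tpure u v) w.
Proof.
have [tl tr] := tpure_bilinear (tens U V) W.
have [sl sr] := tpure_bilinear U V.
have bil (u' : U) : bilinear (fun (v' : V) (w' : W) => tpure (tpure u' v') w').
  by split=> [w' k x y|v' k x y] /=; [rewrite (sr u') tl | exact: tr].
rewrite /tassocV tliftE ?tliftE //; split=> [x|u']; last exact: tlift_linear.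
move=> k u1 u2; rewrite /tlift /plift /mlin scaler_sumr -big_split.
by apply: eq_bigr => p _ /=; rewrite sl tl scalerDr !scalerA mulrC.
Qed.

End Tensor.

Section DualCEDS.
Variables (K : fieldType) (A : lmodType K).

(* The triple tensor power is A (x) (A (x) A); an operator f on A (x) A acts on
   the first two factors through the associator. *)
Definition on23 (f : tens A A -> tens A A) :
    tens A (tens A A) -> tens A (tens A A) :=
  tmap idfun f.

Definition on12 (f : tens A A -> tens A A) :
    tens A (tens A A) -> tens A (tens A A) :=
  @tassoc K A A A \o tmap f idfun \o @tassocV K A A A.

Variable Phi : {linear tens A A -> tens A A}.
Let tau : tens A A -> tens A A := @tflip K A A.

Definition dual_lCEDS : Prop :=
  on23 Phi \o on12 Phi \o on23 Phi =1 on12 Phi \o on23 tau \o on12 Phi /\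
  on12 Phi \o on12 tau \o on23 tau \o on23 Phi =1
    on23 tau \o on23 Phi \o on12 Phi \o on12 tau.

Definition special_vector (lambda : K) (a : A) : Prop :=
  Phi (tpure a a) = lambda *: tpure a a.

Definition weak_special_vector (a : A) : Prop :=
  Phi (tpure a a) + tau (Phi (tpure a a)) = tpure a a.

End DualCEDS.

Section Trees.
Variable A : Type.

(* Node a l r stands for the product of l and r by the generator indexed by a,
   and Leaf i for the i-th input, counted from 0. *)
Inductive tree := Leaf of nat | Node of A & tree & tree.

Fixpoint leaves (t : tree) : seq nat :=
  match t with
  | Leaf i => [:: i]
  | Node _ l r => leaves l ++ leaves r
  end.

Fixpoint tsubst (f : nat -> tree) (t : tree) : tree :=
  match t with
  | Leaf i => f i
  | Node a l r => Node a (tsubst f l) (tsubst f r)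
  end.

Definition trelabel (f : nat -> nat) : tree -> tree := tsubst (Leaf \o f).

(* Grafts s, which has n leaves, onto the leaf i of t; the leaves of s become
   i, ..., i + n - 1 and those of t beyond i are shifted by n - 1. *)
Definition tgraft (n i : nat) (t s : tree) : tree :=
  tsubst (fun j => if (j < i)%N then Leaf j
                   else if j == i then trelabel (addn i) s
                   else Leaf (j + n).-1%N) t.

Definition multilinear (n : nat) (t : tree) : bool :=
  perm_eq (leaves t) (iota 0 n).

Lemma leaves_tsubst f t :
  leaves (tsubst f t) = flatten [seq leaves (f j) | j <- leaves t].
Proof.
elim: t => [i|a l IHl r IHr] /=; first by rewrite cats0.
by rewrite IHl IHr map_cat flatten_cat.
Qed.

Lemma leaves_trelabel f t : leaves (trelabel f t) = map f (leaves t).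
Proof. by rewrite leaves_tsubst -[RHS]flatten_seq1 -map_comp. Qed.

Lemma tgraft_multilinear m n i t s : (i < m)%N ->
  multilinear m t -> multilinear n s -> multilinear (m + n).-1 (tgraft n i t s).
Proof.
rewrite /multilinear => im tm sn; rewrite /tgraft leaves_tsubst.
set g := fun j => leaves _.
have [d md] : exists d, m = (i + d.+1)%N by exists (m - i.+1)%N; lia.
have tE : perm_eq (leaves t) (iota 0 i ++ i :: iota i.+1 d).
  by rewrite (perm_trans tm) // md -[i :: _]/(iota i d.+1) -iotaD.
apply: perm_trans (perm_flatten (perm_map g tE)) _.
have -> : (m + n).-1 = (i + (n + d))%N by lia.
rewrite 2!iotaD add0n map_cat flatten_cat /=.
have -> : flatten (map g (iota 0 i)) = iota 0 i.
  rewrite -[RHS]flatten_seq1; congr flatten; apply/eq_in_map => j.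
  by rewrite mem_iota add0n /g => /andP[_ ->].
rewrite perm_cat2l; apply: perm_cat.
  by rewrite /g ltnn eqxx leaves_trelabel -[X in iota X n]addn0 iotaDl perm_map.
have -> : iota (i + n) d = map (fun j => (j + n).-1) (iota i.+1 d).
  by elim: d i {im md tE sn g tm} => //= d IH i; rewrite -addSn IH.
rewrite -[X in perm_eq _ X]flatten_seq1 -map_comp.
rewrite (_ : map g _ = map (fun j => [:: (j + n).-1]) (iota i.+1 d)) //.
apply/eq_in_map => j; rewrite mem_iota => /andP[ij _].
by rewrite /g ltnNge (ltnW ij) /= gtn_eqF.
Qed.

Lemma tsubst_eq (f g : nat -> tree) t :
  {in leaves t, f =1 g} -> tsubst f t = tsubst g t.
Proof.
elim: t => [i|a l IHl r IHr] /= fg; first by rewrite fg ?inE.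
rewrite IHl => [|i ti]; last by rewrite fg // mem_cat ti.
by rewrite IHr // => i ti; rewrite fg // mem_cat ti orbT.
Qed.

Lemma tgraft_notin n i t s s' : i \notin leaves t ->
  tgraft n i t s = tgraft n i t s'.
Proof.
move=> ti; rewrite /tgraft; apply: tsubst_eq => j tj.
by case: eqP tj ti => // -> ->.
Qed.

End Trees.

Section TreeChoice.
Variable A : choiceType.

Fixpoint tree_encode (t : tree A) : GenTree.tree (nat + A)%type :=
  match t with
  | Leaf i => GenTree.Leaf (inl i)
  | Node a l r =>
      GenTree.Node 0 [:: GenTree.Leaf (inr a); tree_encode l; tree_encode r]
  end.

Fixpoint tree_decode (g : GenTree.tree (nat + A)%type) : option (tree A) :=
  match g with
  | GenTree.Leaf (inl i) => Some (Leaf A i)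
  | GenTree.Node 0 [:: GenTree.Leaf (inr a); l; r] =>
      if (tree_decode l, tree_decode r) is (Some l', Some r')
      then Some (Node a l' r') else None
  | _ => None
  end.

Lemma tree_encodeK : pcancel tree_encode tree_decode.
Proof. by elim=> //= a l -> r ->. Qed.

HB.instance Definition _ := Choice.copy (tree A) (pcan_type tree_encodeK).

End TreeChoice.

Section FreeOperad.
Variables (K : fieldType) (A : lmodType K).

(* t = k t1 + t2 by linearity in the label of a single node. *)
Inductive tree_lin (k : K) : tree A -> tree A -> tree A -> Prop :=
| tree_lin_node a b l r :
    tree_lin k (Node (k *: a + b) l r) (Node a l r) (Node b l r)
| tree_lin_l a l l1 l2 r : tree_lin k l l1 l2 ->
    tree_lin k (Node a l r) (Node a l1 r) (Node a l2 r)
| tree_lin_r a l r r1 r2 : tree_lin k r r1 r2 ->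
    tree_lin k (Node a l r) (Node a l r1) (Node a l r2).

Definition mtree (n : nat) : choiceType := {t : tree A | multilinear n t}.
Definition MTree n t (tn : multilinear n t) : mtree n :=
  exist (fun t => is_true (multilinear n t)) t tn.

Inductive free_rel n : {malg K[mtree n]} -> Prop :=
| FreeRel k (t t1 t2 : mtree n) : tree_lin k (val t) (val t1) (val t2) ->
    free_rel (<< t >> - (k *: << t1 >> + << t2 >>)).

(* Arity n of the free symmetric operad on A (x) K[S_2] placed in arity 2: the
   multilinear trees, modulo linearity in the labels of the nodes. *)
Definition free (n : nat) : Type := lquot (@free_rel n).
HB.instance Definition _ n := GRing.Lmodule.on (free n).

Definition ftree n (t : mtree n) : free n := qpi (@free_rel n) << t >>.

Lemma corolla_multilinear a : multilinear 2 (Node a (Leaf A 0) (Leaf A 1)).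
Proof. by []. Qed.

Definition fgen (a : A) : free 2 := ftree (MTree (corolla_multilinear a)).

Definition permn n (s : 'S_n) (i : nat) : nat :=
  if insub i is Some j then val (s j) else i.

Lemma trelabel_multilinear n (s : 'S_n) (t : tree A) :
  multilinear n t -> multilinear n (trelabel (permn s) t).
Proof.
rewrite /multilinear leaves_trelabel => /(perm_map (permn s))/perm_trans; apply.
have -> : map (permn s) (iota 0 n) = map val (map s (enum 'I_n)).
  rewrite -val_enum_ord -!map_comp; apply/eq_map => j /=.
  by rewrite /permn valK.
rewrite -val_enum_ord perm_map //; apply: uniq_perm.
- by rewrite map_inj_uniq ?enum_uniq //; exact: perm_inj.
- exact: enum_uniq.
move=> j; rewrite mem_enum inE; apply/mapP; exists ((s^-1)%g j) => //.
  by rewrite mem_enum.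
by rewrite permKV.
Qed.

Definition mrelabel n (s : 'S_n) (t : mtree n) : mtree n :=
  MTree (trelabel_multilinear s (valP t)).

Definition mgraft m n (i : 'I_m) (t : mtree m) (s : mtree n) :
    mtree (m + n).-1 :=
  MTree (tgraft_multilinear (ltn_ord i) (valP t) (valP s)).

(* The action of S_n: p(x_0, ..., x_(n-1)) becomes p(x_(s 0), ..., x_(s (n-1))). *)
Definition fact n (s : 'S_n) : free n -> free n :=
  plift (fun t => ftree (mrelabel s t)).

(* The partial composition of p and q at the input i of p. *)
Definition fcomp m n (p : free m) (i : 'I_m) (q : free n) : free (m + n).-1 :=
  plift (fun t => plift (fun s => ftree (mgraft i t s)) q) p.

Lemma ftree_lin n k (t t1 t2 : mtree n) :
  tree_lin k (val t) (val t1) (val t2) -> ftree t = k *: ftree t1 + ftree t2.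
Proof. by move=> tl; exact: (qpi_rel (FreeRel tl)). Qed.

Lemma tree_lin_tsubst k t t1 t2 (f : nat -> tree A) :
  tree_lin k t t1 t2 -> tree_lin k (tsubst f t) (tsubst f t1) (tsubst f t2).
Proof. by elim=> /= *; constructor. Qed.

Lemma tree_lin_graft k n i t s s1 s2 : count_mem i (leaves t) = 1%N ->
  tree_lin k s s1 s2 ->
  tree_lin k (tgraft n i t s) (tgraft n i t s1) (tgraft n i t s2).
Proof.
move=> + slin; rewrite /tgraft; elim: t => [j|a l IHl r IHr] /=.
  rewrite addn0; case: eqP => // -> _.
  by rewrite ltnn; exact: tree_lin_tsubst.
rewrite count_cat; case cl: (count_mem i (leaves l)) => [|[|//]].
  rewrite add0n => cr; have lE u v := tgraft_notin n u v (introT count_memPn cl); rewrite /tgraft in lE.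
  by rewrite (lE s s1) (lE s2 s1); apply: tree_lin_r; exact: IHr.
case=> cr; have rE u v := tgraft_notin n u v (introT count_memPn cr); rewrite /tgraft in rE.
by rewrite (rE s s1) (rE s2 s1); apply: tree_lin_l; exact: IHl.
Qed.

Lemma free_lift n (W : lmodType K) (f : mtree n -> W) :
  (forall k t t1 t2, tree_lin k (val t) (val t1) (val t2) ->
     f t = k *: f t1 + f t2) ->
  linear (plift f : free n -> W) /\ forall t, plift f (ftree t) = f t.
Proof.
move=> fl; have fR r : free_rel r -> mlin f r = 0.
  by case=> k t t1 t2 tl; rewrite mlin_rel (fl _ _ _ _ tl) subrr.
by split=> [|t]; [exact: plift_linear | rewrite plift_pi // mlinU].
Qed.

Lemma fact_spec n (s : 'S_n) : linear (fact s) /\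
  forall t, fact s (ftree t) = ftree (mrelabel s t).
Proof.
by apply: free_lift => k t t1 t2 tl; apply: ftree_lin; exact: tree_lin_tsubst.
Qed.

Lemma fgraft_spec m n (i : 'I_m) (t : mtree m) :
  let f q := plift (fun s : mtree n => ftree (mgraft i t s)) q in
  linear (f : free n -> _) /\ forall s, f (ftree s) = ftree (mgraft i t s).
Proof.
apply: free_lift => k s s1 s2 sl; apply: ftree_lin; apply: tree_lin_graft => //.
by rewrite (seq.permP (valP t)) count_uniq_mem ?iota_uniq // mem_iota ltn_ord.
Qed.

Lemma fcomp_outer m n (i : 'I_m) (q : free n) k (t t1 t2 : mtree m) :
  tree_lin k (val t) (val t1) (val t2) ->
  let f t := plift (fun s : mtree n => ftree (mgraft i t s)) q in
  f t = k *: f t1 + f t2.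
Proof.
move=> tl /=; rewrite /plift /mlin scaler_sumr -big_split.
apply: eq_bigr => s _ /=.
have /ftree_lin -> : tree_lin k (val (mgraft i t s)) (val (mgraft i t1 s))
    (val (mgraft i t2 s)) by exact: tree_lin_tsubst.
by rewrite scalerDr !scalerA mulrC.
Qed.

Lemma fcompE m n (t : mtree m) (i : 'I_m) (s : mtree n) :
  fcomp (ftree t) i (ftree s) = ftree (mgraft i t s).
Proof.
rewrite /fcomp.
have [_ ->] := free_lift (fcomp_outer i (ftree s)).
by have [_ ->] := fgraft_spec n i t.
Qed.

Lemma fcomp_linear_l m n (i : 'I_m) (q : free n) :
  linear (fun p : free m => fcomp p i q).
Proof. by have [] := free_lift (fcomp_outer i q). Qed.

Lemma fcomp_linear_r m n (i : 'I_m) (p : free m) :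
  linear (fun q : free n => fcomp p i q).
Proof.
move=> k q q'; rewrite /fcomp /plift /mlin scaler_sumr -big_split.
apply: eq_bigr => t _ /=; have [fl _] := fgraft_spec n i t.
by have /= := fl k q q'; rewrite /plift /mlin => ->; rewrite scalerDr !scalerA mulrC.
Qed.

End FreeOperad.

Section Perm.
Variables (K : fieldType) (A : lmodType K).
Variable Phi : {linear tens A A -> tens A A}.

(* Families of subspaces of the free operad stable under the symmetric groups
   and under composition with arbitrary elements on both sides. *)
Record operadic_ideal (J : forall n, free A n -> Prop) : Prop := OperadicIdeal {
  ideal0 : forall n, J n 0;
  idealP : forall n k (p q : free A n), J n p -> J n q -> J n (k *: p + q);
  ideal_act : forall n (s : 'S_n) p, J n p -> J n (fact s p);
  ideal_comp_l : forall m n (i : 'I_m) p (q : free A n),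
    J m p -> J (m + n).-1 (fcomp p i q);
  ideal_comp_r : forall m n (i : 'I_m) (p : free A m) (q : free A n),
    J n q -> J (m + n).-1 (fcomp p i q)
}.

Definition swap01 n : 'S_n.+2 := tperm ord0 (Ordinal (isT : 1 < n.+2)%N).

(* With Phi (a (x) b) written as a sum of u (x) v, the relations are
     (x0 <>_b x1) <>_a x2 = sum x0 <>_u (x1 <>_v x2),
     x0 <>_a (x1 <>_b x2) = x1 <>_b (x0 <>_a x2). *)
Inductive perm_rel : free A 3 -> Prop :=
| perm_rel_assoc a b : perm_rel
    (fcomp (fgen a) ord0 (fgen b)
     - tlift (fun u v => fcomp (fgen u) ord_max (fgen v)) (Phi (tpure a b)))
| perm_rel_comm a b : perm_rel
    (fcomp (fgen a) ord_max (fgen b)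
     - fact (swap01 1) (fcomp (fgen b) ord_max (fgen a))).

(* The operadic ideal generated by these relations. *)
Definition perm_ideal n (p : free A n) : Prop :=
  forall J, operadic_ideal J -> (forall r, perm_rel r -> J 3 r) -> J n p.

Definition Perm (n : nat) : Type := lquot (@perm_ideal n).
HB.instance Definition _ n := GRing.Lmodule.on (Perm n).

Definition ppi n (p : free A n) : Perm n := qpi (@perm_ideal n) p.

Definition pact n (s : 'S_n) (p : Perm n) : Perm n := ppi (fact s (qrepr p)).

Definition pcomp m n (p : Perm m) (i : 'I_m) (q : Perm n) : Perm (m + n).-1 :=
  ppi (fcomp (qrepr p) i (qrepr q)).

Definition diamond (a : A) : Perm 2 := ppi (fgen a).

Definition pop (p : Perm 2) : Perm 2 := pact (swap01 0) p.

(* For p in Perm 2 written x <> y: (x0 <> x1) <> x2, x0 <> (x1 <> x2) and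
   x1 <> (x0 <> x2). *)
Definition left_comb (p : Perm 2) : Perm 3 := pcomp p ord0 p.
Definition right_comb (p : Perm 2) : Perm 3 := pcomp p ord_max p.
Definition right_comb_swap (p : Perm 2) : Perm 3 :=
  pact (swap01 1) (right_comb p).

Definition permutative_product (p : Perm 2) : Prop :=
  left_comb p = right_comb p /\ right_comb p = right_comb_swap p.

Definition zero_permutative_product (p : Perm 2) : Prop :=
  left_comb p = 0 /\ right_comb p = right_comb_swap p.

Lemma perm_ideal_operadic : operadic_ideal perm_ideal.
Proof.
split.
- by move=> n J J0 _; apply: ideal0.
- by move=> n k p q Jp Jq J JI Jr; apply: (idealP JI); [exact: Jp | exact: Jq].
- by move=> n s p Jp J JI Jr; apply: (ideal_act JI); exact: Jp.
- by move=> m n i p q Jp J JI Jr; apply: (ideal_comp_l JI); exact: Jp.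
- by move=> m n i p q Jq J JI Jr; apply: (ideal_comp_r JI); exact: Jq.
Qed.

Lemma ppi_eq n (p q : free A n) : ppi p = ppi q <-> perm_ideal (p - q).
Proof.
rewrite /ppi; split=> [/qpi_eq|pq]; last by apply/qpi_eq; exact: span_gen.
elim=> [|k x y Jx _ Jy]; first exact: (ideal0 perm_ideal_operadic).
exact: (idealP perm_ideal_operadic).
Qed.

Lemma perm_ideal_qrepr n (p : free A n) : perm_ideal (qrepr (ppi p) - p).
Proof. by apply/ppi_eq; rewrite /ppi qreprK. Qed.

Lemma pactE n (s : 'S_n) (p : free A n) : pact s (ppi p) = ppi (fact s p).
Proof.
apply/ppi_eq; have [fl _] := fact_spec A s.
rewrite (linear_subr fl).
by apply: (ideal_act perm_ideal_operadic); exact: perm_ideal_qrepr.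
Qed.

Lemma pcompE m n (p : free A m) (i : 'I_m) (q : free A n) :
  pcomp (ppi p) i (ppi q) = ppi (fcomp p i q).
Proof.
rewrite /pcomp; set p' := qrepr (ppi p); set q' := qrepr (ppi q).
transitivity (ppi (fcomp p i q')); apply/ppi_eq.
  have -> := linear_subr (fcomp_linear_l i q') p' p.
  by apply: (ideal_comp_l perm_ideal_operadic); exact: perm_ideal_qrepr.
have -> := linear_subr (fcomp_linear_r i p) q' q.
by apply: (ideal_comp_r perm_ideal_operadic); exact: perm_ideal_qrepr.
Qed.

End Perm.

(* Main.v *)
Require Import Defs.
From HB Require Import structures.
From mathcomp Require Import all_boot all_order all_algebra.
From mathcomp Require Import perm zify finmap monalg.
From mathcomp.classical Require Import boolp classical_sets.
Import Defs.

(* The relations of [Perm Phi] live in arity 3 and no composition lowers the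
   arity, so arity 3 of the operad is just the quotient of the free one by the
   permuted relations: it is three copies of A (x) A, one for each choice of the
   last input z in the normal forms x <>_u (y <>_v z). Any binary product is
   <>_a + <>_b^op. Comparing its combs coefficient by coefficient gives
     Phi (a (x) a) + tau (Phi (a (x) b)) = a (x) a   and
     b (x) b = a (x) b = Phi (b (x) a) + tau (Phi (b (x) b)).
   The second line says (b - a) (x) b = 0, so b = 0 or b = a, which are the two
   families. For the zero products b (x) b = 0, so b = 0. *)

Set Implicit Arguments.
Unset Strict Implicit.
Unset Printing Implicit Defensive.

Import GRing.Theory.
Local Open Scope ring_scope.

(** * Linear maps that are not bundled *)

Section LinearMaps.
Variables (K : fieldType) (U W : lmodType K).
Implicit Types f g : U -> W.

Lemma lin0 f : linear f -> f 0 = 0.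
Proof. by move=> fl; have := linear_subr fl 0 0; rewrite !subrr. Qed.

Lemma linD f : linear f -> {morph f : x y / x + y}.
Proof. by move=> fl x y; rewrite -[x]scale1r fl !scale1r. Qed.

Lemma linear_zero : linear (fun _ : U => 0 : W).
Proof. by move=> k x y; rewrite scaler0 addr0. Qed.

Lemma linear_addf f g : linear f -> linear g -> linear (fun x => f x + g x).
Proof. by move=> fl gl k x y; rewrite fl gl scalerDr addrACA. Qed.

End LinearMaps.

Lemma linear_comp (K : fieldType) (U V W : lmodType K) (f : V -> W) (g : U -> V) :
  linear f -> linear g -> linear (fun x => f (g x)).
Proof. by move=> fl gl k x y; rewrite gl fl. Qed.

(** * Reasoning on generators in a presented vector space *)

Section Presentation.
Variables (K : fieldType) (X : choiceType) (R : {malg K[X]} -> Prop).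

(** A representative is a finite sum over its support, hence built from 0 by adding one scaled
    generator at a time. *)
Lemma lquot_malg_ind (P : lquot R -> Prop) :
  P 0 -> (forall k x q, P q -> P (k *: qpi R << x >> + q)) -> forall q, P q.
Proof.
move=> P0 PS q; rewrite -[q]qreprK [qrepr q]monalgE raddf_sum.
elim: (finmap.enum_fset _) => [|x s IH]; first by rewrite big_nil.
rewrite big_cons.
have -> : << (qrepr q)@_x *g x >> = (qrepr q)@_x *: << x >> :> {malg K[X]}.
  by apply/malgP => y; rewrite mcoeffZ !mcoeffU mulr_natr.
by rewrite /= linearZ; apply: PS.
Qed.

Lemma lquot_malg_ext (W : lmodType K) (f g : lquot R -> W) :
  linear f -> linear g ->
  (forall x, f (qpi R << x >>) = g (qpi R << x >>)) -> f =1 g.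
Proof.
move=> fl gl fg; apply: lquot_malg_ind; first by rewrite !lin0.
by move=> k x q fgq; rewrite fl gl fg fgq.
Qed.

End Presentation.

(** * Tensor products over a field and dual vectors *)

Section TensorFacts.
Variables (K : fieldType) (U V : lmodType K).

Lemma tens_ext (W : lmodType K) (f g : tens U V -> W) :
  linear f -> linear g -> (forall u v, f (tpure u v) = g (tpure u v)) -> f =1 g.
Proof. by move=> fl gl fg; apply: lquot_malg_ext => // -[u v]; exact: fg. Qed.

Lemma tflip_linear : linear (@tflip K U V).
Proof.
apply: tlift_linear; have [tl tr] := tpure_bilinear V U.
by split=> *; rewrite ?tl ?tr.
Qed.

(* A maximal set stable under [k x + y] and avoiding [u] is a hyperplane
   complementary to the line of [u]. *)
Lemma exists_dual_vector (u : U) : u != 0 ->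
  exists2 f : U -> K^o, linear f & f u = 1.
Proof.
move=> u0.
pose stable (M : set U) := forall k x y, M x -> M y -> M (k *: x + y).
pose P (M : set U) := stable M /\ ~ M u.
have [F FP Ftot|M [[Ms Mu] Mmax]] := @Zorn_bigcup U P.
  split=> [k x y [X FX Xx] [Y FY Yy]|[X FX]]; last by have [] := FP _ FX.
  have [XY|YX] := Ftot _ _ FX FY; [exists Y|exists X] => //.
    by apply: (FP _ FY).1 => //; exact: XY.
  by apply: (FP _ FX).1 => //; exact: YX.
(* The empty set satisfies [P], so 0 is not in [M] for free. A maximal set without 0 would be empty,
   as [x] in [M] gives [-1 *: x + x], and [[set 0]] would be strictly larger. *)
have M0 : M 0.
  apply: contrapT => M0; apply: (Mmax [set 0]%classic); last first.
    by split=> [k x y -> ->|/eqP]; rewrite ?scaler0 ?addr0 // (negPf u0).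
  split=> [x Mx|/(_ 0 erefl)//]; exfalso; apply: M0.
  by rewrite -(addNr x) -scaleN1r; exact: Ms.
have MZ k x : M x -> M (k *: x) by move=> Mx; rewrite -[_ *: _]addr0; exact: Ms.
(* Otherwise adjoining the line of [x] to [M] gives a strictly larger set. It still avoids [u]: if
   [u - c *: x] is in [M] then [c != 0], and dividing by [- c] would decompose [x]. *)
have dec x : exists c : K, M (x - c *: u).
  apply: contrapT => Nx.
  apply: (Mmax [set y | exists c : K, M (y - c *: x)]%classic).
    split=> [y My|/(_ x)]; first by exists 0; rewrite scale0r subr0.
    have Bx : exists c : K, M (x - c *: x) by exists 1; rewrite scale1r subrr.
    by move=> /(_ Bx) Mx; apply: Nx; exists 0; rewrite scale0r subr0.
  split=> [k y z [c Mc] [d Md]|[c Mc]].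
    exists (k * c + d); rewrite scalerDl -scalerA opprD addrACA -scalerBr.
    exact: Ms.
  have c0 : c != 0 by apply: contra_notN Mu => /eqP c0; rewrite c0 scale0r subr0 in Mc.
  apply: Nx; exists c^-1; have := MZ (- c^-1) _ Mc.
  by rewrite scalerBr !scaleNr scalerA mulVf // scale1r opprK addrC.
have uniq_dec c d x : M (x - c *: u) -> M (x - d *: u) -> c = d.
  move=> Mc Md; apply/eqP; rewrite -subr_eq0; apply: contra_notT Mu => cd.
  have := Ms (-1) _ _ Mc Md; rewrite scaleN1r opprB addrA subrK -scalerBl.
  by move=> /(MZ (c - d)^-1); rewrite scalerA mulVf // scale1r.
(* Linearity of the chosen coefficient follows from its uniqueness and the stability of [M]. *)
have [f fP] := choice dec.
exists f => [k x y|]; last first.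
  by apply: (uniq_dec _ _ u) => //; rewrite scale1r subrr.
apply: (uniq_dec _ _ (k *: x + y)) => //.
by rewrite scalerDl -scalerA opprD addrACA -scalerBr; exact: Ms.
Qed.

End TensorFacts.

(** If both vectors are nonzero, they have linear forms with value 1 on them, and the product of
    these forms induces a map sending [tpure u v] to 1. *)
Lemma tpure_eq0 (K : fieldType) (U V : lmodType K) (u : U) (v : V) :
  tpure u v = 0 -> u = 0 \/ v = 0.
Proof.
move=> uv0; have [|u0] := eqVneq u 0; first by left.
have [|v0] := eqVneq v 0; first by right.
have [f fl fu] := exists_dual_vector u0; have [g gl gv] := exists_dual_vector v0.
have fg : bilinear (fun (x : U) (y : V) => (f x * g y : K^o)).
  split=> [y k x x'|x k y y']; first by rewrite fl mulrDl -mulrA.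
  by rewrite gl mulrDr mulrCA.
have := tliftE fg u v; rewrite uv0 lin0; last exact: tlift_linear.
by rewrite fu gv mulr1 => /eqP; rewrite eq_sym oner_eq0.
Qed.

(** * Monomials of the free operad and its lowest arities *)

Section Monomials.
Variables (K : fieldType) (A : lmodType K).
Implicit Types t : tree A.

Lemma free_ind n (P : free A n -> Prop) :
  P 0 -> (forall k (t : mtree A n) q, P q -> P (k *: ftree t + q)) -> forall q, P q.
Proof. exact: lquot_malg_ind. Qed.

Lemma free_ext n (W : lmodType K) (f g : free A n -> W) :
  linear f -> linear g -> (forall t : mtree A n, f (ftree t) = g (ftree t)) -> f =1 g.
Proof. exact: lquot_malg_ext. Qed.

(** Total on bare trees, with default value 0, so that trees can be rewritten without transporting
    proofs of multilinearity. *)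
Definition monomial n t : free A n :=
  if insub t is Some t' then ftree t' else 0.

Lemma ftreeE n (t : mtree A n) : ftree t = monomial n (val t).
Proof. by rewrite /monomial valK. Qed.

Lemma monomialE n t (tn : multilinear n t) : monomial n t = ftree (MTree tn).
Proof. by rewrite ftreeE. Qed.

Lemma tree_lin_leaves (k : K) t t1 t2 : tree_lin k t t1 t2 ->
  leaves t1 = leaves t /\ leaves t2 = leaves t.
Proof. by elim=> //= [a l l1 l2 r _ [-> ->]|a l r r1 r2 _ [-> ->]]. Qed.

(** The three trees have the same leaves: either all are multilinear, or all three monomials take
    the default value 0. *)
Lemma monomial_lin n (k : K) t t1 t2 : tree_lin k t t1 t2 ->
  monomial n t = k *: monomial n t1 + monomial n t2.
Proof.
move=> tl; have [l1 l2] := tree_lin_leaves tl.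
have [tn|tn] := boolP (multilinear n t).
  have t1n : multilinear n t1 by rewrite /multilinear l1.
  have t2n : multilinear n t2 by rewrite /multilinear l2.
  by rewrite !monomialE; apply: ftree_lin.
rewrite /monomial !insubN ?scaler0 ?addr0 //.
  by rewrite /multilinear l2.
by rewrite /multilinear l1.
Qed.

Lemma monomial_act n (s : 'S_n) t : multilinear n t ->
  fact s (monomial n t) = monomial n (trelabel (permn s) t).
Proof.
move=> tn; have sn := trelabel_multilinear s tn.
rewrite !monomialE (fact_spec A s).2; congr ftree; exact: val_inj.
Qed.

Lemma monomial_comp m n (i : 'I_m) t t' : multilinear m t -> multilinear n t' ->
  fcomp (monomial m t) i (monomial n t') = monomial (m + n).-1 (tgraft n i t t').
Proof.
move=> tm t'n; have gn := tgraft_multilinear (ltn_ord i) tm t'n.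
by rewrite !monomialE fcompE; congr ftree; exact: val_inj.
Qed.

Lemma size_leaves_gt0 t : (0 < size (leaves t))%N.
Proof. by elim: t => //= a l IHl r _; rewrite size_cat addn_gt0 IHl. Qed.

Lemma size_leaves n t : multilinear n t -> size (leaves t) = n.
Proof. by move=> /perm_size; rewrite size_iota. Qed.

Lemma free0_eq0 (q : free A 0) : q = 0.
Proof.
elim/free_ind: q => // k [t tn] q _.
by have := size_leaves_gt0 t; rewrite (size_leaves tn).
Qed.

(** A node has at least two leaves, so the operad unit is the only tree of arity 1. *)
Lemma mtree1E (t : mtree A 1) : val t = Leaf A 0.
Proof.
case: t => [[i|a l r] tn] /=.
  by have := perm_mem tn i; rewrite !inE eqxx => /esym/eqP ->.
have := size_leaves tn; have := size_leaves_gt0 l; have := size_leaves_gt0 r.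
by rewrite /= size_cat; case: size => // x; case: size => // y; rewrite addnS.
Qed.

Lemma tgraft_unit i t : tgraft 1 i t (Leaf A 0) = t.
Proof.
rewrite /tgraft; elim: t => /= [j|a l -> r -> //].
(* A leaf [j] beyond [i] becomes [(j + 1).-1], that is [j] again. *)
by case: ltnP => // _; case: eqP => [->|_]; rewrite ?addn1 // /trelabel /= addn0.
Qed.

Lemma trelabel_id f t : f =1 id -> trelabel f t = t.
Proof. by move=> fE; rewrite /trelabel; elim: t => /= [j|a l -> r -> //]; rewrite fE. Qed.

Lemma permnK n (s : 'S_n) : cancel (permn s) (permn s^-1%g).
Proof.
move=> i; rewrite /permn; case: (@insubP _ _ 'I_n i) => [j _ <-|ni];
  last by rewrite insubN.
by rewrite valK permK.
Qed.

Lemma permnKV n (s : 'S_n) : cancel (permn s^-1%g) (permn s).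
Proof. by move=> i; rewrite -{1}[s]invgK permnK. Qed.

Lemma permn_swap01 n i :
  permn (swap01 n) i = if i == 0%N then 1%N else if i == 1%N then 0%N else i.
Proof.
rewrite /permn /swap01; case: insubP => [j _ <-|].
  case: tpermP => [->|->|/eqP j0 /eqP j1] //=.
  by rewrite -!val_eqE /= in j0 j1; rewrite (negPf j0) (negPf j1).
by case: i => [|[]].
Qed.

(** Used to carry the relations, stated on the inputs 0, 1, 2, to any order of the inputs. *)
Lemma permn_seq n (s : seq nat) : perm_eq s (iota 0 n) ->
  exists p : 'S_n, forall i, (i < n)%N -> permn p i = nth 0%N s i.
Proof.
move=> sn; have ss : size s = n by rewrite (perm_size sn) size_iota.
have si (i : 'I_n) : (nth 0 s i < n)%N.
  have : nth 0%N s i \in s by rewrite mem_nth ?ss.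
  by rewrite (perm_mem sn) mem_iota.
have inj : injective (fun i => Ordinal (si i)).
  move=> i j [/eqP]; rewrite nth_uniq ?ss // => [/eqP|]; first exact: val_inj.
  by rewrite (perm_uniq sn) iota_uniq.
by exists (perm inj) => i lin; rewrite /permn insubT permE.
Qed.

End Monomials.

(** * Coefficients in arity 3 and the ideal they define *)

Section Coefficients.
Variables (K : fieldType) (A : lmodType K).
Variable Phi : {linear tens A A -> tens A A}.

(** The flip encodes [x <>_u (y <>_v z) = y <>_v (x <>_u z)]. The innermost input [z] is not
    recorded, since in arity 3 the other two determine it. *)
Definition orient (i j x y : nat) (w : tens A A) : tens A A :=
  if (x == i) && (y == j) then w
  else if (x == j) && (y == i) then tflip w else 0.

(* In arity 3 every element of [Perm] is uniquely a combination of normal forms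
   [x_i <>_u (x_j <>_v x_k)] with [i < j]; this is the coefficient of [u (x) v]
   there, and its flip for [j < i]. The value on trees that do not have
   three leaves is junk. *)
Definition tree_coef (i j : nat) (t : tree A) : tens A A :=
  match t with
  | Node a (Leaf x) (Node b (Leaf y) (Leaf _)) => orient i j x y (tpure a b)
  | Node a (Node b (Leaf x) (Leaf y)) (Leaf _) => orient i j x y (Phi (tpure a b))
  | _ => 0
  end.

Definition coef n (i j : nat) : free A n -> tens A A :=
  plift (fun t => tree_coef i j (val t)).

Lemma orient_linear i j x y : linear (orient i j x y).
Proof.
rewrite /orient.
case: ((x == i) && (y == j)) => //.
by case: ((x == j) && (y == i)); [exact: tflip_linear|exact: linear_zero].
Qed.

(** This lets [coef] descend from trees to [free]. Only two-node shapes contribute, and there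
    linearity in a label is that of [tpure], [Phi] and [orient]. *)
Lemma tree_coef_lin i j k t t1 t2 : tree_lin k t t1 t2 ->
  tree_coef i j t = k *: tree_coef i j t1 + tree_coef i j t2.
Proof.
have [tl tr] := tpure_bilinear A A; have z : 0 = k *: 0 + 0 :> tens A A.
  by rewrite scaler0 addr0.
case=> [a b l r|a l l1 l2 r ll|a l r r1 r2 rl].
- case: l r => [x|c [x|? ? ?] [y|? ? ?]] [z'|d [y'|? ? ?] [z'|? ? ?]] //=.
    by rewrite tl orient_linear.
  by rewrite tl linearP orient_linear.
- case: ll => [c d l' r'|? ? ? ? ? []|? [?|? ? ?] ? ? ? []] //=.
  case: l' r' r => [x|? ? ?] [y|? ? ?] [w|? ? ?] //=.
  by rewrite tr linearP orient_linear.
- case: l => [x|? [] ? [] ?] /=;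
    case: rl => [c d l' r'|? ? ? ? ? []|? [?|? ? ?] ? ? ? []] //=.
  case: l' r' => [y|? ? ?] [w|? ? ?] //=.
  by rewrite tr orient_linear.
Qed.

Lemma coef_linear n i j : linear (@coef n i j).
Proof.
have [cl _] := @free_lift K A n _ _ (fun k t t1 t2 => @tree_coef_lin i j k _ _ _).
exact: cl.
Qed.

Lemma coef_ftree n i j (t : mtree A n) : coef i j (ftree t) = tree_coef i j (val t).
Proof.
have [_ tE] := @free_lift K A n _ _ (fun k t t1 t2 => @tree_coef_lin i j k _ _ _).
exact: tE.
Qed.

Lemma coef_monomial n i j t : multilinear n t ->
  coef i j (monomial n t) = tree_coef i j t.
Proof. by move=> tn; rewrite monomialE coef_ftree. Qed.

(** Leaf labels enter only through equality tests, so a bijective relabelling becomes its inverse on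
    the indices. *)
Lemma tree_coef_trelabel f g i j t : cancel f g -> cancel g f ->
  tree_coef i j (trelabel f t) = tree_coef (g i) (g j) t.
Proof.
move=> fK gK; have E x y : (f x == y) = (x == g y) by rewrite (can2_eq fK gK).
case: t => //= a [x|b [x|? ? ?] [y|? ? ?]] [z|c [y'|? ? ?] [z|? ? ?]] //=;
  by rewrite /orient !E.
Qed.

Lemma coef_fact n (s : 'S_n) i j p :
  coef i j (fact s p) = coef (permn s^-1%g i) (permn s^-1%g j) p.
Proof.
move: p; apply: free_ext => [||t]; try exact: coef_linear.
  by apply: linear_comp; [exact: coef_linear|exact: (fact_spec A s).1].
rewrite (fact_spec A s).2 !coef_ftree /=; apply: tree_coef_trelabel.
  exact: permnK.
exact: permnKV.
Qed.

Lemma coef_comp_linear_l m n (i : 'I_m) (q : free A n) x y :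
  linear (fun p => coef x y (fcomp p i q)).
Proof. by apply: linear_comp; [exact: coef_linear|exact: fcomp_linear_l]. Qed.

Lemma coef_comp_linear_r m n (i : 'I_m) (p : free A m) x y :
  linear (fun q : free A n => coef x y (fcomp p i q)).
Proof. by apply: linear_comp; [exact: coef_linear|exact: fcomp_linear_r]. Qed.

Lemma coef_unit_r m (i : 'I_m) (q : free A 1) x y p :
  coef x y p = 0 -> coef x y (fcomp p i q) = 0.
Proof.
move=> p0; move: q; apply: free_ext => [||t].
- exact: coef_comp_linear_r.
- exact: linear_zero.
(* Writing 0 as [coef x y p] makes the goal an identity between linear maps of [p], which can be
   checked on trees. *)
rewrite -[RHS]p0; move: p {p0}; apply: free_ext => [||t'].
- exact: coef_comp_linear_l.
- exact: coef_linear.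
by rewrite fcompE !coef_ftree /= mtree1E tgraft_unit.
Qed.

Lemma coef_unit_l n (i : 'I_1) (p : free A 1) x y (q : free A n) :
  coef x y q = 0 -> coef x y (fcomp p i q) = 0.
Proof.
move=> q0; move: p; apply: free_ext => [||t].
- exact: coef_comp_linear_l.
- exact: linear_zero.
rewrite -[RHS]q0; move: q {q0}; apply: free_ext => [||t'].
- exact: coef_comp_linear_r.
- exact: coef_linear.
by rewrite fcompE [LHS]coef_ftree [RHS]coef_ftree /= mtree1E ord1 /tgraft /= trelabel_id.
Qed.

(* The free operad is zero in arity 0 and the scalars in arity 1, so no
   composition lowers the arity and this is an operadic ideal. *)
Definition coef_ideal n (p : free A n) : Prop :=
  ((n <= 2)%N -> p = 0) /\ (n = 3 -> forall i j, coef i j p = 0).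

Lemma coef_ideal0 n : coef_ideal (0 : free A n).
Proof. by split=> // _ i j; rewrite lin0 //; exact: coef_linear. Qed.

Lemma coef_ideal_operadic : operadic_ideal coef_ideal.
Proof.
split=> [||n s p [p0 pc]|m n i p q [p0 pc]|m n i p q [q0 qc]].
- exact: coef_ideal0.
- move=> n k p q [p0 pc] [q0 qc]; split=> [n2|n3 i j].
    by rewrite p0 ?q0 // scaler0 addr0.
  by rewrite coef_linear pc ?qc // scaler0 addr0.
- split=> [n2|n3 i j]; last by rewrite coef_fact pc.
  by rewrite p0 // lin0 //; exact: (fact_spec A s).1.
- have [m2|m2] := leqP m 2.
    by rewrite p0 // (lin0 (fcomp_linear_l i q)); exact: coef_ideal0.
  case: n q => [|n] q.
    by rewrite (free0_eq0 q) (lin0 (fcomp_linear_r i p)); exact: coef_ideal0.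
  (* Now [q] has arity [n.+1] and the composite has arity [m + n] with [m > 2]: it equals 3 only if
     [m = 3] and [q] has arity 1. *)
  split=> [mn2|mn3 x y]; first by exfalso; lia.
  have m3 : m = 3 by lia.
  have n0 : n = 0%N by lia.
  by subst m n; apply: coef_unit_r; exact: pc.
- have [n2|n2] := leqP n 2.
    by rewrite q0 // (lin0 (fcomp_linear_r i p)); exact: coef_ideal0.
  (* The input [i] forces [m > 0], so the composite has arity at least [n], and arity 3 only if
     [n = 3] and [m = 1]. *)
  split=> [mn2|mn3 x y]; first by exfalso; have := ltn_ord i; lia.
  have n3 : n = 3 by have := ltn_ord i; lia.
  have m1 : m = 1%N by have := ltn_ord i; lia.
  by subst m n; apply: coef_unit_l; exact: qc.
Qed.

End Coefficients.

(** * Normal forms in arity 3 of the operad *)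

Section NormalForms.
Variables (K : fieldType) (A : lmodType K).
Variable Phi : {linear tens A A -> tens A A}.
Local Notation ppi := (@ppi K A Phi).
Local Notation coef := (coef Phi).

Definition ltree x y z (a b : A) : tree A :=
  Node a (Node b (Leaf A x) (Leaf A y)) (Leaf A z).

Definition rtree x y z (a b : A) : tree A :=
  Node a (Leaf A x) (Node b (Leaf A y) (Leaf A z)).

Definition rcomb x y z : tens A A -> free A 3 :=
  tlift (fun u v => monomial 3 (rtree x y z u v)).

Lemma rtree_bilinear x y z : bilinear (fun u v => monomial 3 (rtree x y z u v)).
Proof. by split=> [v k u u'|u k v v']; apply: monomial_lin; repeat constructor. Qed.

Lemma rcomb_linear x y z : linear (rcomb x y z).
Proof. exact: tlift_linear (rtree_bilinear x y z). Qed.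

Lemma rcombE x y z u v : rcomb x y z (tpure u v) = monomial 3 (rtree x y z u v).
Proof. exact: tliftE (rtree_bilinear x y z) u v. Qed.

Opaque rcomb.

Lemma coef_rcomb i j x y z w : perm_eq [:: x; y; z] (iota 0 3) ->
  coef i j (rcomb x y z w) = orient i j x y w.
Proof.
move=> xyz; move: w; apply: tens_ext => [||u v]; last first.
- by rewrite rcombE coef_monomial.
- exact: orient_linear.
- by apply: linear_comp; [exact: coef_linear|exact: rcomb_linear].
Qed.

Lemma fact_rcomb (s : 'S_3) x y z w : perm_eq [:: x; y; z] (iota 0 3) ->
  fact s (rcomb x y z w) = rcomb (permn s x) (permn s y) (permn s z) w.
Proof.
move=> xyz; move: w; apply: tens_ext => [||u v]; last first.
- by rewrite !rcombE monomial_act.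
- exact: rcomb_linear.
- by apply: linear_comp; [exact: (fact_spec A s).1|exact: rcomb_linear].
Qed.

Lemma fgenE (a : A) : fgen a = monomial 2 (Node a (Leaf A 0) (Leaf A 1)).
Proof. exact: ftreeE. Qed.

Lemma fcomp_fgen_l (a b : A) :
  fcomp (fgen a) ord0 (fgen b) = monomial 3 (ltree 0 1 2 a b).
Proof. by rewrite fcompE ftreeE. Qed.

Lemma fcomp_fgen_r (a b : A) :
  fcomp (fgen a) ord_max (fgen b) = monomial 3 (rtree 0 1 2 a b).
Proof. by rewrite fcompE ftreeE. Qed.

Opaque fcomp fgen fact monomial tlift tflip tpure.

Lemma ppi_linear n : linear (@Defs.ppi K A Phi n).
Proof. by move=> k x y; rewrite /Defs.ppi linearP. Qed.

Lemma ppi0P n (p : free A n) : ppi p = 0 <-> perm_ideal Phi p.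
Proof. by rewrite -[in perm_ideal _ _](subr0 p) -ppi_eq (lin0 (@ppi_linear n)). Qed.

Lemma ppi_fact_rel (s : 'S_3) r : perm_rel Phi r -> ppi (fact s r) = 0.
Proof.
move=> rr; apply/ppi0P; apply: (ideal_act (perm_ideal_operadic Phi)).
by move=> J _; exact.
Qed.

Lemma tlift_fcomp_fgen w :
  tlift (fun u v => fcomp (fgen u) ord_max (fgen v) : free A 3) w = rcomb 0 1 2 w.
Proof.
have -> // : (fun u v => fcomp (fgen u) ord_max (fgen v) : free A 3) =
  (fun u v => monomial 3 (rtree 0 1 2 u v)).
by apply/funext => u; apply/funext => v; exact: fcomp_fgen_r.
Qed.

Lemma perm_rel_assocE a b :
  perm_rel Phi (monomial 3 (ltree 0 1 2 a b) - rcomb 0 1 2 (Phi (tpure a b))).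
Proof.
rewrite -fcomp_fgen_l -tlift_fcomp_fgen; exact: perm_rel_assoc.
Qed.

Lemma perm_rel_commE a b :
  perm_rel Phi (monomial 3 (rtree 0 1 2 a b) - monomial 3 (rtree 1 0 2 b a)).
Proof.
have <- : fact (swap01 1) (monomial 3 (rtree 0 1 2 b a)) =
    monomial 3 (rtree 1 0 2 b a).
  by rewrite monomial_act // /trelabel /= !permn_swap01.
rewrite -2!fcomp_fgen_r.
exact: perm_rel_comm.
Qed.

(** The associativity relation, moved by the permutation with values [x], [y], [z], rewrites left
    combs into right combs. *)
Lemma ppi_ltree x y z a b : perm_eq [:: x; y; z] (iota 0 3) ->
  ppi (monomial 3 (ltree x y z a b)) = ppi (rcomb x y z (Phi (tpure a b))).
Proof.
move=> xyz; have [s sE] := permn_seq xyz.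
have := ppi_fact_rel s (perm_rel_assocE a b).
rewrite -(linear_subr (fact_spec A s).1) -(linear_subr (@ppi_linear 3)).
rewrite monomial_act // fact_rcomb // !sE //= /trelabel /= !sE //= => /eqP.
by rewrite subr_eq0 => /eqP.
Qed.

Lemma ppi_rcomb_flip x y z w : perm_eq [:: x; y; z] (iota 0 3) ->
  ppi (rcomb x y z w) = ppi (rcomb y x z (tflip w)).
Proof.
move=> xyz; have [s sE] := permn_seq xyz.
move: w; apply: tens_ext => [||u v].
- by apply: linear_comp; [exact: ppi_linear|exact: rcomb_linear].
- apply: linear_comp; first exact: ppi_linear.
  by apply: linear_comp; [exact: rcomb_linear|exact: tflip_linear].
have := ppi_fact_rel s (perm_rel_commE u v).
rewrite -(linear_subr (fact_spec A s).1) -(linear_subr (@ppi_linear 3)).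
rewrite tflipE !rcombE !monomial_act // /trelabel /= !sE //= => /eqP.
by rewrite subr_eq0 => /eqP.
Qed.

Lemma multilinear3E (t : tree A) : multilinear 3 t ->
  exists a b x y z, perm_eq [:: x; y; z] (iota 0 3) /\
    (t = ltree x y z a b \/ t = rtree x y z a b).
Proof.
move=> t3; have := size_leaves t3; have {t3} := t3; rewrite /multilinear.
have gt0 := @size_leaves_gt0 K A.
case: t => [//|a [x|b l r] r'] /=.
  case: r' => [//|b [y|c l r] [z|d l' r']] xyz /=.
  - by move=> _; exists a, b, x, y, z; split=> //; right.
  - by rewrite !size_cat; have := gt0 l'; have := gt0 r'; lia.
  - by rewrite !size_cat /=; have := gt0 l; have := gt0 r; lia.
  - rewrite !size_cat; have := gt0 l; have := gt0 r.
    by have := gt0 l'; have := gt0 r'; lia.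
case: l r r' => [x|c l l'] [y|d r r'] [z|e u u'] xyz /=.
- by move=> _; exists a, b, x, y, z; split=> //; left.
all: rewrite !size_cat /= ?size_cat.
all: try have := gt0 l; try have := gt0 l'; try have := gt0 r; try have := gt0 r'.
all: try have := gt0 u; try have := gt0 u'; lia.
Qed.

Definition normal_form (p : free A 3) : free A 3 :=
  rcomb 0 1 2 (coef 0 1 p) + rcomb 0 2 1 (coef 0 2 p) + rcomb 1 2 0 (coef 1 2 p).

Lemma normal_form_linear : linear normal_form.
Proof.
have l x y z i j : linear (fun p : free A 3 => rcomb x y z (coef i j p)).
  by apply: linear_comp; [exact: rcomb_linear|exact: coef_linear].
exact: linear_addf (linear_addf (l 0 1 2 0 1)%N (l 0 2 1 0 2)%N) (l 1 2 0 1 2)%N.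
Qed.

(** For each of the six orders two of the summands vanish; the third is the given comb, after one
    flip when [y < x]. *)
Lemma ppi_rcomb_orient x y z w : perm_eq [:: x; y; z] (iota 0 3) ->
  ppi (rcomb x y z w) = ppi (rcomb 0 1 2 (orient 0 1 x y w)
    + rcomb 0 2 1 (orient 0 2 x y w) + rcomb 1 2 0 (orient 1 2 x y w)).
Proof.
move=> xyz; have : [:: x; y; z] \in permutations [:: 0; 1; 2]%N.
  by rewrite mem_permutations.
have r0 x' y' z' : rcomb x' y' z' 0 = 0 by rewrite lin0 //; exact: rcomb_linear.
rewrite !inE => /or4P[|||/or3P[]] /eqP[-> -> ->];
  rewrite /orient /= !r0 ?addr0 ?add0r.
- exact: ppi_rcomb_flip.
- exact: erefl.
- exact: ppi_rcomb_flip.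
- exact: erefl.
- exact: erefl.
- exact: ppi_rcomb_flip.
Qed.

Lemma ppi_normal_form p : ppi p = ppi (normal_form p).
Proof.
move: p; apply: free_ext => [||[t t3]]; first exact: ppi_linear.
  by apply: linear_comp; [exact: ppi_linear|exact: normal_form_linear].
rewrite /normal_form !coef_ftree ftreeE /=.
have [a [b [x [y [z [xyz [->|->]]]]]]] := multilinear3E t3.
  by rewrite ppi_ltree // ppi_rcomb_orient.
by rewrite -rcombE ppi_rcomb_orient.
Qed.

(** Vanishing coefficients kill the normal form. Conversely, [coef_ideal] is an operadic ideal
    containing the relations, hence contains [perm_ideal], which gives the independence of normal
    forms. *)
Lemma ppi_eq0 (p : free A 3) : ppi p = 0 <-> forall i j, coef i j p = 0.
Proof.
split=> [/ppi0P pI|p0]; last first.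
  rewrite ppi_normal_form /normal_form !p0.
  have r0 x y z : rcomb x y z 0 = 0 by rewrite lin0 //; exact: rcomb_linear.
  by rewrite !r0 !addr0 lin0 //; exact: ppi_linear.
have [_] : coef_ideal Phi p; last exact.
apply: pI => [|r rr]; first exact: coef_ideal_operadic.
split=> // _ i j; case: rr => a b.
  rewrite tlift_fcomp_fgen fcomp_fgen_l.
  rewrite -(linear_subr (coef_linear Phi i j)).
  by rewrite coef_monomial // coef_rcomb // subrr.
suff : coef i j (monomial 3 (rtree 0 1 2 a b)
    - fact (swap01 1) (monomial 3 (rtree 0 1 2 b a))) = 0.
  rewrite -2!fcomp_fgen_r.
  exact.
rewrite monomial_act //.
rewrite -(linear_subr (coef_linear Phi i j)).
rewrite coef_monomial // coef_monomial; last exact: trelabel_multilinear.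
rewrite /= !permn_swap01 /= /orient !tflipE.
by case: i j => [|[|i]] [|[|j]]; rewrite /= subrr.
Qed.

Lemma coef_fcomp_monomial m n (i : 'I_m) t t' x y :
  multilinear m t -> multilinear n t' ->
  coef x y (fcomp (monomial m t) i (monomial n t')) =
  tree_coef Phi x y (tgraft n i t t').
Proof.
move=> tm tn; rewrite monomial_comp // coef_monomial //.
exact: tgraft_multilinear.
Qed.

Lemma coef_fcompD m n (i : 'I_m) (p1 p2 : free A m) (q1 q2 : free A n) x y :
  coef x y (fcomp (p1 + p2) i (q1 + q2)) =
    coef x y (fcomp p1 i q1) + coef x y (fcomp p1 i q2)
    + (coef x y (fcomp p2 i q1) + coef x y (fcomp p2 i q2)).
Proof.
apply: etrans (linD (coef_comp_linear_l Phi i (q1 + q2) x y) p1 p2) _.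
by congr (_ + _); exact: (linD (coef_comp_linear_r Phi i _ x y) q1 q2).
Qed.

(** * Binary products and the coefficients of their combs *)

Definition binary (a b : A) : free A 2 :=
  monomial 2 (Node a (Leaf A 0) (Leaf A 1))
  + monomial 2 (Node b (Leaf A 1) (Leaf A 0)).

(** The four terms come from [(x0 <>_a x1) <>_a x2], [(x1 <>_b x0) <>_a x2], [x2 <>_b (x0 <>_a x1)]
    and [x2 <>_b (x1 <>_b x0)]. *)
Lemma coef_left_binary (a b : A) i j :
  coef i j (fcomp (binary a b) ord0 (binary a b)) =
    orient i j 0 1 (Phi (tpure a a)) + orient i j 1 0 (Phi (tpure a b))
    + (orient i j 2 0 (tpure b a) + orient i j 2 1 (tpure b b)).
Proof.
apply: etrans (coef_fcompD _ _ _ _ _ _ _) _.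
by congr (_ + _ + (_ + _)); apply: etrans (coef_fcomp_monomial _ _ _ _ _) _.
Qed.

Lemma coef_right_binary (a b : A) i j :
  coef i j (fcomp (binary a b) ord_max (binary a b)) =
    orient i j 0 1 (tpure a a) + orient i j 0 2 (tpure a b)
    + (orient i j 1 2 (Phi (tpure b a)) + orient i j 2 1 (Phi (tpure b b))).
Proof.
apply: etrans (coef_fcompD _ _ _ _ _ _ _) _.
by congr (_ + _ + (_ + _)); apply: etrans (coef_fcomp_monomial _ _ _ _ _) _.
Qed.

Lemma ppi_eq3P (p q : free A 3) : ppi p = ppi q <->
  [/\ coef 0 1 p = coef 0 1 q, coef 0 2 p = coef 0 2 q & coef 1 2 p = coef 1 2 q].
Proof.
split=> [pq|[e01 e02 e12]]; last first.
  by rewrite ppi_normal_form [RHS]ppi_normal_form /normal_form e01 e02 e12.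
have /ppi_eq0 pq0 : ppi (p - q) = 0.
  by rewrite -(linear_subr (@ppi_linear 3)) pq subrr.
have e i j : coef i j p = coef i j q.
  apply/eqP; rewrite -subr_eq0; apply/eqP.
  by rewrite (linear_subr (coef_linear Phi i j)).
by split; apply: e.
Qed.

Lemma binary_linear k (a b a' b' : A) :
  binary (k *: a + a') (k *: b + b') = k *: binary a b + binary a' b'.
Proof.
rewrite /binary (monomial_lin _ (tree_lin_node k a a' _ _)).
by rewrite (monomial_lin _ (tree_lin_node k b b' _ _)) scalerDr addrACA.
Qed.

(** Linearity in the label [0 = 1 *: 0 + 0] makes the monomial equal to twice itself. *)
Lemma monomial_node0 n l r : monomial n (Node 0 l r) = 0 :> free A n.
Proof.
have := monomial_lin n (tree_lin_node 1 0 0 l r : tree_lin (1 : K) _ _ _).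
rewrite scaler0 addr0 scale1r => /eqP.
by rewrite -subr_eq subrr eq_sym => /eqP.
Qed.

(** A tree of arity 2 is one node with its leaves in either order; the missing summand gets the
    label 0. *)
Lemma binaryP (q : free A 2) : exists a b, q = binary a b.
Proof.
elim/free_ind: q => [|k [t t2] q [a [b ->]]].
  by exists 0, 0; rewrite /binary !monomial_node0 addr0.
suff [c [d tE]] : exists c d, monomial 2 t = binary c d.
  have -> : ftree (MTree t2) = binary c d by rewrite -tE monomialE.
  by exists (k *: c + a), (k *: d + b); rewrite binary_linear.
move: (t2) (size_leaves t2).
have gt0 := @size_leaves_gt0 K A.
case: t {t2} => [//|c [x|? l l'] [y|? r r']] xy /=; last 3 first.
- by rewrite !size_cat; have := gt0 r; have := gt0 r'; lia.
- by rewrite !size_cat /=; have := gt0 l; have := gt0 l'; lia.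
- by rewrite !size_cat; have := gt0 l; have := gt0 l'; have := gt0 r; lia.
move=> _; have : [:: x; y] \in permutations [:: 0; 1]%N by rewrite mem_permutations.
rewrite !inE => /orP[] /eqP[-> ->].
  by exists c, 0; rewrite /binary monomial_node0 addr0.
by exists 0, c; rewrite /binary monomial_node0 add0r.
Qed.

Lemma diamond_binary a : diamond Phi a = ppi (binary a 0).
Proof. by rewrite /diamond fgenE /binary monomial_node0 addr0. Qed.

Lemma diamond_pop_binary a :
  diamond Phi a + pop (diamond Phi a) = ppi (binary a a).
Proof.
rewrite /pop /diamond pactE fgenE monomial_act // /trelabel /= !permn_swap01 /=.
exact: esym (linD (@ppi_linear 2) _ _).
Qed.

Lemma left_comb_binary a b :
  left_comb (ppi (binary a b)) = ppi (fcomp (binary a b) ord0 (binary a b)).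
Proof. exact: (pcompE Phi (binary a b) ord0 (binary a b)). Qed.

Lemma right_comb_binary a b :
  right_comb (ppi (binary a b)) = ppi (fcomp (binary a b) ord_max (binary a b)).
Proof. exact: (pcompE Phi (binary a b) ord_max (binary a b)). Qed.

Lemma right_comb_swap_binary a b : right_comb_swap (ppi (binary a b)) =
  ppi (fact (swap01 1) (fcomp (binary a b) ord_max (binary a b) : free A 3)).
Proof. by rewrite /right_comb_swap right_comb_binary; exact: (pactE Phi (swap01 1)). Qed.

Lemma left_coefs a b (p := fcomp (binary a b) ord0 (binary a b) : free A 3) :
  [/\ coef 0 1 p = Phi (tpure a a) + tflip (Phi (tpure a b)),
      coef 0 2 p = tpure a b & coef 1 2 p = tpure b b].
Proof.
split; apply: etrans (coef_left_binary _ _ _ _) _;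
  by rewrite /orient /= ?tflipE ?addr0 ?add0r.
Qed.

Lemma right_coefs a b (p := fcomp (binary a b) ord_max (binary a b) : free A 3) :
  [/\ coef 0 1 p = tpure a a, coef 0 2 p = tpure a b
    & coef 1 2 p = Phi (tpure b a) + tflip (Phi (tpure b b))].
Proof.
split; apply: etrans (coef_right_binary _ _ _ _) _;
  by rewrite /orient /= ?tflipE ?addr0 ?add0r.
Qed.

Lemma right_swap_coefs a b
  (p := fact (swap01 1) (fcomp (binary a b) ord_max (binary a b) : free A 3)) :
  [/\ coef 0 1 p = tpure a a, coef 1 2 p = tpure a b
    & coef 0 2 p = Phi (tpure b a) + tflip (Phi (tpure b b))].
Proof.
(* Being its own inverse, the transposition exchanges the coefficients at (0,2) and (1,2) and reads
   the one at (0,1) as that at (1,0). *)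
have sV i : permn (swap01 1)^-1%g i = permn (swap01 1) i by rewrite tpermV.
split; apply: etrans (coef_fact Phi _ _ _ _) _; rewrite !sV !permn_swap01 /=;
  apply: etrans (coef_right_binary _ _ _ _) _;
  by rewrite /orient /= ?tflipE ?addr0 ?add0r.
Qed.

(** Of the six coefficient equations, associativity at (0,2) and permutativity at (0,1) are trivial,
    and permutativity gives the same equation at (0,2) and (1,2). *)
Lemma binary_permutativeP a b : permutative_product (ppi (binary a b)) <->
  [/\ Phi (tpure a a) + tflip (Phi (tpure a b)) = tpure a a,
      tpure b b = tpure a b
    & tpure a b = Phi (tpure b a) + tflip (Phi (tpure b b))].
Proof.
rewrite /permutative_product left_comb_binary right_comb_swap_binary.
rewrite right_comb_binary.
have [l01 l02 l12] := left_coefs a b.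
have [r01 r02 r12] := right_coefs a b.
have [s01 s12 s02] := right_swap_coefs a b.
have lr := ppi_eq3P (fcomp (binary a b) ord0 (binary a b))
  (fcomp (binary a b) ord_max (binary a b)).
have rs := ppi_eq3P (fcomp (binary a b) ord_max (binary a b))
  (fact (swap01 1) (fcomp (binary a b) ord_max (binary a b) : free A 3)).
split=> [[/lr[e01 _ e12] /rs[_ f02 f12]]|[e01 bb ab]].
  split; first exact: etrans (etrans (esym l01) e01) r01.
    exact: etrans (esym l12) (etrans e12 (etrans f12 s12)).
  exact: etrans (esym r02) (etrans f02 s02).
split.
  apply/lr; split.
  - exact: etrans l01 (etrans e01 (esym r01)).
  - exact: etrans l02 (esym r02).
  - exact: etrans l12 (etrans bb (etrans ab (esym r12))).
apply/rs; split.
- exact: etrans r01 (esym s01).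
- exact: etrans r02 (etrans ab (esym s02)).
- exact: etrans r12 (etrans (esym ab) (esym s12)).
Qed.

Lemma binary_zero_permutativeP a b : zero_permutative_product (ppi (binary a b)) <->
  [/\ Phi (tpure a a) + tflip (Phi (tpure a b)) = 0,
      tpure a b = 0, tpure b b = 0
    & Phi (tpure b a) + tflip (Phi (tpure b b)) = 0].
Proof.
rewrite /zero_permutative_product left_comb_binary right_comb_swap_binary.
rewrite right_comb_binary.
have [l01 l02 l12] := left_coefs a b.
have [r01 r02 r12] := right_coefs a b.
have [s01 s12 s02] := right_swap_coefs a b.
have l0 := ppi_eq3P (fcomp (binary a b) ord0 (binary a b)) 0.
have p0 : ppi (0 : free A 3) = 0 by rewrite lin0 //; exact: ppi_linear.
have c0 i j : coef i j (0 : free A 3) = 0 by rewrite lin0 //; exact: coef_linear.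
rewrite p0 !c0 in l0.
have rs := ppi_eq3P (fcomp (binary a b) ord_max (binary a b))
  (fact (swap01 1) (fcomp (binary a b) ord_max (binary a b) : free A 3)).
split=> [[/l0[e01 e02 e12] /rs[_ f02 f12]]|[e01 ab bb ba]].
  have ab : tpure a b = 0 := etrans (esym l02) e02.
  split.
  - exact: etrans (esym l01) e01.
  - exact: ab.
  - exact: etrans (esym l12) e12.
  - exact: etrans (esym s02) (etrans (esym f02) (etrans r02 ab)).
split.
  apply/l0; split.
  - exact: etrans l01 e01.
  - exact: etrans l02 ab.
  - exact: etrans l12 bb.
apply/rs; split.
- exact: etrans r01 (esym s01).
- exact: etrans r02 (etrans ab (etrans (esym ba) (esym s02))).
- exact: etrans r12 (etrans ba (etrans (esym ab) (esym s12))).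
Qed.

End NormalForms.

Theorem proposition3p6 (K : fieldType) (charK : [pchar K] =i pred0)
    (A : lmodType K) (Phi : {linear tens A A -> tens A A})
    (PhiD : dual_lCEDS Phi) :
  (forall p : Perm Phi 2, permutative_product p <->
     (exists2 a : A, special_vector Phi 1 a & p = diamond Phi a) \/
     (exists2 a : A, weak_special_vector Phi a &
        p = diamond Phi a + pop (diamond Phi a))) /\
  (forall p : Perm Phi 2, zero_permutative_product p <->
     (exists2 a : A, special_vector Phi 0 a & p = diamond Phi a)).
Proof.
have t0l (b : A) : tpure 0 b = 0 :> tens A A := lin0 ((tpure_bilinear A A).1 b).
have t0r (a : A) : tpure a 0 = 0 :> tens A A := lin0 ((tpure_bilinear A A).2 a).
have flip0 : tflip 0 = 0 :> tens A A := lin0 (@tflip_linear K A A).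
have Phi0 : Phi 0 = 0 := linear0 Phi.
(* Only existence of the labels is used, obtained from a representative in the free operad. *)
have binary_repr (p : Perm Phi 2) : exists a b, p = ppi Phi (binary a b).
  have [a [b pE]] := binaryP (qrepr p).
  by exists a, b; rewrite -pE /ppi qreprK.
split=> p; split.
- have [a [b ->]] := binary_repr p.
  case/binary_permutativeP => e01 bb _.
  have : tpure (b - a) b = 0.
    rewrite -(linear_subr ((tpure_bilinear A A).1 b)) bb; exact: subrr.
  case/tpure_eq0 => [/eqP|b0].
    rewrite subr_eq0 => /eqP ba; subst b; right; exists a => //.
    by rewrite diamond_pop_binary.
  subst b; left; exists a; last by rewrite diamond_binary.
  by move: e01; rewrite t0r Phi0 flip0 addr0 /special_vector scale1r.
- case=> -[a sa ->].
    rewrite diamond_binary; apply/binary_permutativeP.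
    rewrite !t0r !t0l !Phi0 !flip0 !addr0; split; [|exact: erefl|exact: erefl].
    by move: sa; rewrite /special_vector scale1r.
  rewrite diamond_pop_binary; apply/binary_permutativeP.
  (* At [b = a] the outer two equations are the weak special equation read in both directions. *)
  by split; [exact: sa|exact: erefl|exact: esym sa].
- have [a [b ->]] := binary_repr p.
  case/binary_zero_permutativeP => e01 _ bb _.
  have b0 : b = 0 by case: (tpure_eq0 bb).
  subst b; exists a; last by rewrite diamond_binary.
  by move: e01; rewrite t0r Phi0 flip0 addr0 /special_vector scale0r.
- case=> a sa ->.
  rewrite diamond_binary; apply/binary_zero_permutativeP.
  rewrite !t0r !t0l !Phi0 !flip0 !addr0; split; [|exact: erefl..].
  by move: sa; rewrite /special_vector scale0r.
Qed.
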